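(* Let $\{G_i:i\in I\}$ be an arbitrary family of topological groups and let $G=\prod_{i\in I}G_i$ be its direct product with the Tychonoff product topology. Every controllable subgroup of $G$ is weakly controllable in $G$.
   Context: $\bigoplus_{i\in I}G_i$ denotes the subgroup of all $g\in G=\prod_{i\in I}G_i$ such that $g(i)$ is the identity of $G_i$ for all but finitely many $i\in I$. For $J\subseteq I$, $p_{IJ}:\prod_{i\in I}G_i\to\prod_{j\in J}G_j$ is the projection $g\mapsto g\restriction_J$. A subgroup $H$ of $G$ is: controllable in $G$ if $p_{IJ}(H)=p_{IJ}(H\cap\bigoplus_{i\in I}G_i)$ for every finite set $J\subseteq I$; weakly controllable in $G$ if $H\cap\bigoplus_{i\in I}G_i$ is dense in $H$. *)

(* Defs.v *)
From HB Require Import structures.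
From mathcomp Require Import all_boot all_order all_algebra.
From mathcomp Require Import all_classical all_reals all_analysis.

Set Implicit Arguments.
Unset Strict Implicit.
Unset Printing Implicit Defensive.

Local Open Scope classical_set_scope.
Local Open Scope group_scope.

HB.mixin Record Group_isTopological G of Topological G & Group G := {
  mulg_continuous : continuous (fun x : G * G => x.1 * x.2);
  invg_continuous : continuous (fun x : G => x^-1)
}.

(* No separation axiom and no commutativity. *)
#[short(type="topologicalGroupType")]
HB.structure Definition TopologicalGroup :=
  {G of Topological G & Group G & Group_isTopological G}.

Section ProductGroup.
Context {I : Type} (G : I -> topologicalGroupType).

Let P := prod_topology G.

Definition prod_one : P := fun i => 1.
Definition prod_mul (f g : P) : P := fun i => f i * g i.
Definition prod_inv (f : P) : P := fun i => (f i)^-1.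

Fact prod_mulA : associative prod_mul.
Proof. by move=> f g h; apply/functional_extensionality_dep => i; exact: mulgA. Qed.

Fact prod_mul1 : left_id prod_one prod_mul.
Proof. by move=> f; apply/functional_extensionality_dep => i; exact: mul1g. Qed.

Fact prod_mulr1 : right_id prod_one prod_mul.
Proof. by move=> f; apply/functional_extensionality_dep => i; exact: mulg1. Qed.

Fact prod_mulV : left_inverse prod_one prod_inv prod_mul.
Proof. by move=> f; apply/functional_extensionality_dep => i; exact: mulVg. Qed.

Fact prod_mulrV : right_inverse prod_one prod_inv prod_mul.
Proof. by move=> f; apply/functional_extensionality_dep => i; exact: mulgV. Qed.

HB.instance Definition _ := isGroup.Build (prod_topology G)
  prod_mulA prod_mul1 prod_mulr1 prod_mulV prod_mulrV.

Fact prod_coord_continuous i : continuous (fun f : P => f i).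
Proof. exact: (@proj_continuous {classic I} G i). Qed.

Fact prod_continuous (T : topologicalType) (h : T -> P) :
  (forall i, continuous (fun x => h x i)) -> continuous h.
Proof.
move=> hc x; apply/cvg_sup => i U [_ [[V oV <-] Vhx] VU].
apply: (filterS VU); apply: (hc i x).
exact: open_nbhs_nbhs.
Qed.

Fact prod_mul_continuous : continuous (fun x : P * P => x.1 * x.2).
Proof.
apply: prod_continuous => i x.
apply: (@continuous_comp _ _ _ (fun x : P * P => (x.1 i, x.2 i))
          (fun y : G i * G i => y.1 * y.2)); last exact: mulg_continuous.
apply: cvg_pair.
- apply: (@continuous_comp _ _ _ fst (fun f : P => f i)); first exact: cvg_fst.
  exact: prod_coord_continuous.
- apply: (@continuous_comp _ _ _ snd (fun f : P => f i)); first exact: cvg_snd.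
  exact: prod_coord_continuous.
Qed.

Fact prod_inv_continuous : continuous (fun x : P => x^-1).
Proof.
apply: prod_continuous => i x.
apply: (@continuous_comp _ _ _ (fun f : P => f i) (fun y : G i => y^-1)).
  exact: prod_coord_continuous.
exact: invg_continuous.
Qed.

HB.instance Definition _ := Group_isTopological.Build (prod_topology G)
  prod_mul_continuous prod_inv_continuous.

End ProductGroup.

Section Controllability.
Context {I : Type} {G : I -> topologicalGroupType}.
Implicit Types (H : set (prod_topology G)) (J : set I).

Definition direct_sum : set (prod_topology G) :=
  [set g | finite_set [set i | g i <> 1]].

Definition prod_proj J (g : prod_topology G) :
    prod_topology (fun j : set_type J => G (\val j)) :=
  fun j => g (\val j).

Arguments prod_proj J g : clear implicits.

Definition controllable H := forall J, finite_set J ->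
  prod_proj J @` H = prod_proj J @` (H `&` direct_sum).

(* H carries the subspace topology, here that of the type [set_type H]. *)
Definition weakly_controllable H :=
  dense [set h : set_type H | (H `&` direct_sum) (\val h)].

End Controllability.

Arguments direct_sum {I} G.

Fact direct_sum_group_closed (I : Type) (G : I -> topologicalGroupType) :
  group_closed [in direct_sum G].
Proof.
split=> [|f g /set_mem ff /set_mem fg]; apply/mem_set; rewrite /direct_sum /=.
  rewrite (_ : [set i | _] = set0); first exact: finite_set0.
  by apply/seteqP; split=> i //=; apply.
apply: (@sub_finite_set _ _ ([set i | f i <> 1] `|` [set i | g i <> 1])).
  move=> i /= fgi; apply/not_andP => -[f1 g1]; apply: fgi.
  rewrite [LHS](_ : _ = f i * (g i)^-1) //.
  by move: f1 g1 => -> ->; rewrite invg1 mulg1.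
by rewrite finite_setU.
Qed.

(* Main.v *)
Require Import Defs.
From mathcomp Require Import all_boot all_order all_algebra.
From mathcomp Require Import all_classical all_reals all_analysis.

Local Open Scope classical_set_scope.

(** A neighbourhood of [f] in a Tychonoff product constrains only finitely many
    coordinates: it contains every point that agrees with [f] on some finite
    index set [J] (lemma [open_agreement]).  A nonempty relatively open subset
    of [H] is the trace of an open [U] containing some [h] in [H]; take such a
    [J] for [U] and [h].  Controllability provides an element of [H] of finite
    support with the same projection to [J] as [h].  It agrees with [h] on [J],
    so it lies in [U]. *)

Section Agreement.
Context {I : Type} {K : I -> topologicalType}.
Implicit Types f : prod_topology K.

(** This is the neighbourhood filter of [f] for the product of the discrete
    topologies.  Phrasing finite agreement as a filter reduces the comparison
    with the product topology to one coordinate at a time. *)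
Definition agreement_filter f : set_system (prod_topology K) :=
  [set U | exists2 J : set I, finite_set J &
    forall g : prod_topology K, (forall j, J j -> g j = f j) -> U g].

Instance agreement_filter_filter f : Filter (agreement_filter f).
Proof.
split.
- by exists set0; first exact: finite_set0.
- move=> U V [J finJ JU] [L finL LV].
  exists (J `|` L); first by rewrite finite_setU.
  by move=> g gf; split; [apply: JU|apply: LV] => j ?; apply: gf; [left|right].
- by move=> U V UV [J finJ JU]; exists J => // g /JU /UV.
Qed.

(** Convergence in the product topology is tested on each coordinate [i]
    separately, and there agreement on the singleton of [i] suffices. *)
Lemma agreement_filter_cvg f : agreement_filter f --> f.
Proof.
apply/cvg_sup => i U [_ [[V oV <-] Vfi] VU].
by exists [set i]; [exact: finite_set1|move=> g gf; apply: VU; rewrite /= gf].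
Qed.

Lemma open_agreement f (U : set (prod_topology K)) : open U -> U f ->
  exists2 J : set I, finite_set J &
    forall g : prod_topology K, (forall j, J j -> g j = f j) -> U g.
Proof.
by move=> oU Uf; apply: (agreement_filter_cvg f); exact: open_nbhs_nbhs.
Qed.

End Agreement.

Theorem proposition1p5 (I : Type) (G : I -> topologicalGroupType)
    (H : set (prod_topology G)) (H_subgroup : group_closed [in H]) :
  controllable H -> weakly_controllable H.
Proof.
move=> ctrlH O [h Oh] [U oU UO]; rewrite -UO in Oh.
have [J finJ JU] := open_agreement (\val h) U oU Oh.
have : (@prod_proj I G J @` H) (@prod_proj I G J (\val h)).
  by exists (\val h) => //; apply/set_mem/valP.
rewrite (ctrlH _ finJ) => -[k [Hk finsupp_k] kh].
exists (SigSub (mem_set Hk)); split; last by split.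
rewrite -UO /=; apply: JU => j Jj.
exact: (congr1 (fun g => g (SigSub (mem_set Jj))) kh).
Qed.
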